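(* Let $\Omega$ be a finite set, $G$ a finite set of maps $\Omega\to\Omega$, $H:\Omega\to\mathbb{R}$, $\beta>0$, and consider the Glauber dynamics with rates $c(\eta,\sigma)=\exp\big(-\frac{\beta}{2}(H(\sigma\eta)-H(\eta))\big)$ and reversible measure $m(\eta)=\frac1{Z_\beta}e^{-\beta H(\eta)}$. Suppose that for all $\eta\in\Omega$ and $\sigma,\gamma\in G$ we have $\sigma\gamma\eta=\gamma\sigma\eta$, $\sigma=\sigma^{-1}$ (i.e. $\sigma\sigma\eta=\eta$) and $\kappa(\eta,\sigma)\ge0$, where $$\kappa(\eta,\sigma)=c(\sigma\eta,\sigma)-\sum_{\gamma\in G,\ \gamma\ne\sigma}\max\{-(c(\sigma\eta,\gamma)-c(\eta,\gamma)),\,0\}.$$ Set $$\kappa_*=\inf_{\eta\in\Omega,\sigma\in G}\big(\kappa(\eta,\sigma)+\kappa(\sigma\eta,\sigma)\big),\qquad \overline{\kappa_*}=\inf_{\eta\in\Omega,\sigma\in G}\kappa(\eta,\sigma).$$ Let $\theta:(0,\infty)^2\to[0,\infty)$ be a weight function that is not identically $0$, symmetric, differentiable and concave. Then for all $\rho:\Omega\to(0,\infty)$ and $\psi:\Omega\to\mathbb{R}$, $$\mathscr{B}(\rho,\psi)\ \ge\ \Big(M_\theta\,\overline{\kappa_*}+\frac{\kappa_*}{2}\Big)\,\mathscr{A}(\rho,\psi).$$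
   Context: Notation: $\sigma\eta$ denotes $\sigma(\eta)$; $Z_\beta$ is the normalizing constant making $m$ a probability measure. $G$ does not contain the identity map $e$. The chain is assumed irreducible. The generator is $\mathcal{L}\psi(\eta)=\sum_{\sigma\in G}c(\eta,\sigma)(\psi(\sigma\eta)-\psi(\eta))$, and $S=\{(\eta,\sigma)\in\Omega\times G:c(\eta,\sigma)>0\}$ (here $S=\Omega\times G$). $$M_\theta=\inf_{s,t>0:\ \theta(s,t)>0}\frac{\theta(s,s)+\theta(t,t)}{2\theta(s,t)}\in[0,1].$$ For $\rho:\Omega\to(0,\infty)$, $\psi:\Omega\to\mathbb{R}$: $$\mathscr{A}(\rho,\psi)=\tfrac12\sum_{(\eta,\sigma)\in S}m(\eta)c(\eta,\sigma)\,\theta(\rho(\eta),\rho(\sigma\eta))\,[\psi(\eta)-\psi(\sigma\eta)]^2,$$ $$\mathscr{C}(\rho,\psi)=\tfrac14\sum_{(\eta,\sigma)\in S}m(\eta)c(\eta,\sigma)\Big\{\partial_1\theta(\rho(\eta),\rho(\sigma\eta))\,\mathcal{L}\rho(\eta)+\partial_2\theta(\rho(\eta),\rho(\sigma\eta))\,\mathcal{L}\rho(\sigma\eta)\Big\}[\psi(\eta)-\psi(\sigma\eta)]^2,$$ $$\mathscr{D}(\rho,\psi)=\tfrac12\sum_{(\eta,\sigma)\in S}m(\eta)c(\eta,\sigma)\,\theta(\rho(\eta),\rho(\sigma\eta))(\psi(\eta)-\psi(\sigma\eta))(\mathcal{L}\psi(\eta)-\mathcal{L}\psi(\sigma\eta)),$$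 and $\mathscr{B}=\mathscr{C}-\mathscr{D}$. *)

(* Defs.v *)
From mathcomp Require Import all_boot all_order all_algebra.
From mathcomp Require Import all_classical all_reals all_analysis.
Set Implicit Arguments.
Unset Strict Implicit.
Unset Printing Implicit Defensive.
Import Order.TTheory GRing.Theory Num.Theory.
Import numFieldNormedType.Exports.
Local Open Scope classical_set_scope.
Local Open Scope ring_scope.

(* A set G of maps Omega -> Omega is a [{set {ffun Omega -> Omega}}], so that
   equality of its elements is equality of maps.  Jump rates are total
   functions of (eta, sigma); only their values for sigma in G are used. *)

Definition irreducible_chain (R : realType) (Omega : finType)
    (G : {set {ffun Omega -> Omega}})
    (c : Omega -> {ffun Omega -> Omega} -> R) : Prop :=
  forall eta xi : Omega,
    connect (fun x y =>
      [exists sigma in G, (0 < c x sigma) && (y == sigma x)]) eta xi.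

Definition generator (R : realType) (Omega : finType)
    (G : {set {ffun Omega -> Omega}})
    (c : Omega -> {ffun Omega -> Omega} -> R)
    (psi : Omega -> R) (eta : Omega) : R :=
  \sum_(sigma in G) c eta sigma * (psi (sigma eta) - psi eta).

Definition glauber_rate (R : realType) (Omega : finType) (beta : R)
    (H : Omega -> R) (eta : Omega) (sigma : {ffun Omega -> Omega}) : R :=
  expR (- (beta / 2) * (H (sigma eta) - H eta)).

Definition partition_function (R : realType) (Omega : finType) (beta : R)
    (H : Omega -> R) : R :=
  \sum_(eta : Omega) expR (- beta * H eta).

Definition gibbs_measure (R : realType) (Omega : finType) (beta : R)
    (H : Omega -> R) (eta : Omega) : R :=
  (partition_function beta H)^-1 * expR (- beta * H eta).

Definition kappa (R : realType) (Omega : finType)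
    (G : {set {ffun Omega -> Omega}})
    (c : Omega -> {ffun Omega -> Omega} -> R)
    (eta : Omega) (sigma : {ffun Omega -> Omega}) : R :=
  c (sigma eta) sigma -
  \sum_(gamma in G | gamma != sigma)
    Num.max (- (c (sigma eta) gamma - c eta gamma)) 0.

Definition kappa_star (R : realType) (Omega : finType)
    (G : {set {ffun Omega -> Omega}})
    (c : Omega -> {ffun Omega -> Omega} -> R) : R :=
  inf [set x : R | exists (eta : Omega) (sigma : {ffun Omega -> Omega}),
    sigma \in G /\ x = kappa G c eta sigma + kappa G c (sigma eta) sigma].

Definition kappa_star_bar (R : realType) (Omega : finType)
    (G : {set {ffun Omega -> Omega}})
    (c : Omega -> {ffun Omega -> Omega} -> R) : R :=
  inf [set x : R | exists (eta : Omega) (sigma : {ffun Omega -> Omega}),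
    sigma \in G /\ x = kappa G c eta sigma].

(* A weight theta : (0, +oo)^2 -> [0, +oo) is a function on R * R whose values
   outside [pos_quadrant R] are never used; this set being open, derivatives
   at its points do not depend on those values either. *)
Definition pos_quadrant (R : realType) : set (R * R) :=
  [set p | 0 < p.1 /\ 0 < p.2].

Local Open Scope convex_scope.
(* The same form as [convex_function], with the inequality reversed. *)
Definition concave_function (R : numFieldType) (E : lmodType R)
    (E' := convex_lmodType E) (D : set E') (f : E' -> R^o) : Prop :=
  forall t : {i01 R},
    {in D &, forall x y : E',
      (f x <| t |> f y <= f (x <| t |> y))%R}.
Local Close Scope convex_scope.

Definition partial1 (R : realType) (theta : R * R -> R) (s t : R) : R :=
  derive1 (fun x : R => theta (x, t)) s.

Definition partial2 (R : realType) (theta : R * R -> R) (s t : R) : R :=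
  derive1 (fun y : R => theta (s, y)) t.

Definition M_weight (R : realType) (theta : R * R -> R) : R :=
  inf [set x : R | exists s t : R, [/\ 0 < s, 0 < t, 0 < theta (s, t) &
    x = (theta (s, s) + theta (t, t)) / (2 * theta (s, t))]].

Definition calA (R : realType) (Omega : finType)
    (G : {set {ffun Omega -> Omega}})
    (c : Omega -> {ffun Omega -> Omega} -> R) (m : Omega -> R)
    (theta : R * R -> R) (rho psi : Omega -> R) : R :=
  2^-1 * \sum_(eta : Omega) \sum_(sigma in G | 0 < c eta sigma)
    m eta * c eta sigma * theta (rho eta, rho (sigma eta)) *
    (psi eta - psi (sigma eta)) ^+ 2.

Definition calC (R : realType) (Omega : finType)
    (G : {set {ffun Omega -> Omega}})
    (c : Omega -> {ffun Omega -> Omega} -> R) (m : Omega -> R)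
    (theta : R * R -> R) (rho psi : Omega -> R) : R :=
  4^-1 * \sum_(eta : Omega) \sum_(sigma in G | 0 < c eta sigma)
    m eta * c eta sigma *
    (partial1 theta (rho eta) (rho (sigma eta)) * generator G c rho eta +
     partial2 theta (rho eta) (rho (sigma eta)) *
       generator G c rho (sigma eta)) *
    (psi eta - psi (sigma eta)) ^+ 2.

Definition calD (R : realType) (Omega : finType)
    (G : {set {ffun Omega -> Omega}})
    (c : Omega -> {ffun Omega -> Omega} -> R) (m : Omega -> R)
    (theta : R * R -> R) (rho psi : Omega -> R) : R :=
  2^-1 * \sum_(eta : Omega) \sum_(sigma in G | 0 < c eta sigma)
    m eta * c eta sigma * theta (rho eta, rho (sigma eta)) *
    (psi eta - psi (sigma eta)) *
    (generator G c psi eta - generator G c psi (sigma eta)).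

Definition calB (R : realType) (Omega : finType)
    (G : {set {ffun Omega -> Omega}})
    (c : Omega -> {ffun Omega -> Omega} -> R) (m : Omega -> R)
    (theta : R * R -> R) (rho psi : Omega -> R) : R :=
  calC G c m theta rho psi - calD G c m theta rho psi.

(* Main.v *)
(** Couple the moves out of [eta] and [sigma eta]: for [gamma != sigma] both
    points jump by [gamma] with the minimum of their two rates, and the excess
    rate of the faster point is matched with a [sigma]-jump of the other one.
    What is left of the [sigma]-jumps has rates [kappa eta sigma] and
    [kappa (sigma eta) sigma] and makes the two points coincide.  On each
    coupled move, concavity bounds the first order variation of [theta] in C
    from below by its increment, and the square is completed in D.  This leaves
    [theta' d^2 - theta d'^2], where [d] is the difference of [psi] along the
    pair and primes denote values after the move.  By reversibility these terms
    cancel in the sum over all pairs, up to the coalescing moves.  There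
    [d' = 0], and what remains is bounded by [M_weight], [kappa_star_bar] and
    [kappa_star]. *)

Require Import Defs.
From mathcomp Require Import all_boot all_order all_algebra.
From mathcomp Require Import all_classical all_reals all_analysis.
From mathcomp Require Import ring lra.
Import Order.TTheory GRing.Theory Num.Theory.
Import numFieldNormedType.Exports.
Local Open Scope classical_set_scope.
Local Open Scope ring_scope.

(** * First order bounds for concave functions *)

(** By concavity the difference quotient from [p] towards [q] is at least [f q - f p] for every step
    [h] with [0 < h <= 1], and this survives the limit from the right. *)
Lemma concave_le_derive (R : realType) (V : normedModType R)
    (D : set (convex_lmodType V)) (f : V -> R^o) (p q : V) :
  concave_function D f -> D p -> D q -> derivable f p (q - p) ->
  f q - f p <= 'D_(q - p) f p.
Proof.
move=> fconc Dp Dq df.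
apply: (cvgr_to_ge (cvg_dnbhs_at_right df)).
near=> h.
have h_gt0 : 0 < h by near: h; exact: nbhs_right_gt.
have h_le1 : h <= 1 by near: h; exact: nbhs_right_le.
have fh : h * f q + (1 - h) * f p <= f (h *: (q - p) + p).
  have -> : h *: (q - p) + p = h *: q + (1 - h) *: p.
    by rewrite scalerBr scalerBl scale1r -addrA [- _ + p]addrC.
  by apply: (fconc (Itv01 (ltW h_gt0) h_le1)); rewrite inE.
rewrite -[X in _ <= X]/(h^-1 * (f (h *: (q - p) + p) - f p)).
by rewrite ler_pdivlMl //; lra.
Unshelve. all: by end_near. Qed.

Lemma partial1_diff (R : realType) (theta : R * R -> R) (s t : R) :
  differentiable theta (s, t) ->
  partial1 theta s t = 'd theta (s, t) (1, 0).
Proof.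
move=> dtheta; rewrite -deriveE// /partial1 /derive1 /derive.
set d := (fun _ : R => _); set d' := (fun _ : R => _).
(* Both derivatives are limits of the same difference quotient. *)
suff -> : d = d' by [].
apply/funext => h; rewrite /d /d' /=; congr (_ *: (theta _ - _)).
by congr (_, _); rewrite /= /GRing.scale /= !(mulr0, mulr1, add0r).
Qed.

Lemma partial2_diff (R : realType) (theta : R * R -> R) (s t : R) :
  differentiable theta (s, t) ->
  partial2 theta s t = 'd theta (s, t) (0, 1).
Proof.
move=> dtheta; rewrite -deriveE// /partial2 /derive1 /derive.
set d := (fun _ : R => _); set d' := (fun _ : R => _).
suff -> : d = d' by [].
apply/funext => h; rewrite /d /d' /=; congr (_ *: (theta _ - _)).
by congr (_, _); rewrite /= /GRing.scale /= !(mulr0, mulr1, add0r).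
Qed.

(** The total differential splits the derivative along [(s' - s, t' - t)] into the two partials. *)
Lemma concave_le_partials (R : realType) (theta : R * R -> R)
    (s t s' t' : R) :
  concave_function (@pos_quadrant R) theta ->
  differentiable theta (s, t) ->
  0 < s -> 0 < t -> 0 < s' -> 0 < t' ->
  theta (s', t') - theta (s, t) <=
  partial1 theta s t * (s' - s) + partial2 theta s t * (t' - t).
Proof.
move=> thetac dtheta s0 t0 s'0 t'0.
apply: le_trans (_ : 'D_((s', t') - (s, t)) theta (s, t) <= _).
  have := @concave_le_derive R _ _ theta (s, t) (s', t') thetac.
  by apply => //; exact: diff_derivable.
rewrite deriveE// partial1_diff// partial2_diff//.
have -> : (s', t') - (s, t) = (s' - s) *: (1, 0) + (t' - t) *: (0, 1) :> R * R.
  by congr (_, _); rewrite /= /GRing.scale /= !(mulr0, mulr1, addr0, add0r).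
rewrite linearD !linearZ /= /GRing.scale /=.
by rewrite [X in X + _]mulrC [X in _ + X]mulrC.
Qed.

(** * The generator on a coupled pair *)

Section Generator.
Context {R : realType} {Omega : finType}.
Variables (G : {set {ffun Omega -> Omega}})
  (c : Omega -> {ffun Omega -> Omega} -> R).

Lemma generator_linear (a b : R) (f g : Omega -> R) (eta : Omega) :
  generator G c (fun x => a * f x + b * g x) eta =
  a * generator G c f eta + b * generator G c g eta.
Proof.
rewrite /generator !mulr_sumr -big_split; apply: eq_bigr => sigma _ /=.
by ring.
Qed.

(* The coupling of the header, tested on the function [u x + v y] of the pair:
   such functions only see the two marginals of a coupling. *)
Lemma generator_coupling (u v : Omega -> R) (eta : Omega)
    (sigma : {ffun Omega -> Omega}) :
  sigma \in G -> sigma (sigma eta) = eta ->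
  generator G c u eta + generator G c v (sigma eta) =
  \sum_(gamma in G | gamma != sigma)
    (Num.min (c eta gamma) (c (sigma eta) gamma) *
       (u (gamma eta) + v (gamma (sigma eta)) - (u eta + v (sigma eta))) +
     Num.max (c eta gamma - c (sigma eta) gamma) 0 *
       (u (gamma eta) + v eta - (u eta + v (sigma eta))) +
     Num.max (c (sigma eta) gamma - c eta gamma) 0 *
       (u (sigma eta) + v (gamma (sigma eta)) - (u eta + v (sigma eta)))) +
  kappa G c eta sigma * (u eta + v eta - (u eta + v (sigma eta))) +
  kappa G c (sigma eta) sigma *
    (u (sigma eta) + v (sigma eta) - (u eta + v (sigma eta))).
Proof.
move=> sG sK; rewrite /generator !(bigD1 sigma sG) /= /kappa sK.
set S1 := \sum_(i in G | _) c eta i * _.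
set S2 := \sum_(i in G | _) c (sigma eta) i * _.
set P := \sum_(i in G | _) Num.max (- (c (sigma eta) i - c eta i)) 0.
set U := \sum_(i in G | _) Num.max (- (c eta i - c (sigma eta) i)) 0.
set T := \sum_(i in G | _) _.
(* For each [gamma] the minimum and the excess add up to the full rate of either point, which gives
   [S1] and [S2]; the compensating [sigma]-jumps have total rates [P] and [U], the amounts that
   [kappa] subtracts. *)
have -> : T = S1 + S2 + (v eta - v (sigma eta)) * P +
    (u (sigma eta) - u eta) * U.
  rewrite !mulr_sumr -!big_split; apply: eq_bigr => gamma _ /=.
  rewrite !opprB.
  have [cc|cc] := leP (c eta gamma) (c (sigma eta) gamma).
    by rewrite max_r ?subr_le0// max_l ?subr_ge0//; ring.
  by rewrite max_l ?subr_ge0 1?ltW// max_r ?subr_le0 1?ltW//; ring.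
by ring.
Qed.

End Generator.

(** * Cancellation of antisymmetric terms by reversibility *)

Section Cancellation.
Context {R : realType} {Omega : finType}.
Variables (G : {set {ffun Omega -> Omega}})
  (c : Omega -> {ffun Omega -> Omega} -> R) (m : Omega -> R).
Hypothesis G_comm : forall (eta : Omega) (sigma gamma : {ffun Omega -> Omega}),
  sigma \in G -> gamma \in G -> sigma (gamma eta) = gamma (sigma eta).
Hypothesis G_invol : forall (eta : Omega) (sigma : {ffun Omega -> Omega}),
  sigma \in G -> sigma (sigma eta) = eta.
Hypothesis rate_ge0 : forall (eta : Omega) (sigma : {ffun Omega -> Omega}),
  sigma \in G -> 0 <= m eta * c eta sigma.
Hypothesis balance : forall (eta : Omega) (sigma : {ffun Omega -> Omega}),
  sigma \in G -> m (sigma eta) * c (sigma eta) sigma = m eta * c eta sigma.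
Hypothesis square_balance :
  forall (eta : Omega) (sigma gamma : {ffun Omega -> Omega}),
  sigma \in G -> gamma \in G ->
  m (gamma eta) * c (gamma eta) sigma * c (gamma eta) gamma =
  m (sigma eta) * c (sigma eta) sigma * c (sigma eta) gamma.

Let sum_sym
    (F : Omega -> {ffun Omega -> Omega} -> {ffun Omega -> Omega} -> R) :=
  \sum_eta \sum_(sigma in G) \sum_(gamma in G | gamma != sigma)
    F eta sigma gamma.

Let sum_symE F : sum_sym F =
  \sum_(sigma in G) \sum_(gamma in G | gamma != sigma) \sum_eta
    F eta sigma gamma.
Proof.
rewrite /sum_sym exchange_big /=; apply: eq_bigr => sigma _.
exact: exchange_big.
Qed.

Let eq_sum_sym F F' :
  (forall eta sigma gamma, sigma \in G -> gamma \in G ->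
    F eta sigma gamma = F' eta sigma gamma) ->
  sum_sym F = sum_sym F'.
Proof.
move=> FF'; apply: eq_bigr => eta _; apply: eq_bigr => sigma sG.
by apply: eq_bigr => gamma /andP[gG _]; exact: FF'.
Qed.

Let sum_symN F :
  sum_sym (fun eta sigma gamma => - F eta sigma gamma) = - sum_sym F.
Proof.
rewrite -sumrN; apply: eq_bigr => eta _.
by rewrite -sumrN; apply: eq_bigr => sigma _; rewrite sumrN.
Qed.

Let sum_symD F F' :
  sum_sym (fun eta sigma gamma => F eta sigma gamma + F' eta sigma gamma) =
  sum_sym F + sum_sym F'.
Proof.
rewrite -big_split; apply: eq_bigr => eta _.
by rewrite -big_split; apply: eq_bigr => sigma _; rewrite -big_split.
Qed.

Let G_inj sigma : sigma \in G -> injective sigma.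
Proof. by move=> sG; apply: can_inj => eta; exact: G_invol. Qed.

Let sum_sym_shiftr F :
  sum_sym F = sum_sym (fun eta sigma gamma => F (gamma eta) sigma gamma).
Proof.
rewrite !sum_symE; apply: eq_bigr => sigma _.
apply: eq_bigr => gamma /andP[gG _].
by rewrite (reindex_inj (G_inj _ gG)).
Qed.

Let sum_sym_shiftl F :
  sum_sym F = sum_sym (fun eta sigma gamma => F (sigma eta) sigma gamma).
Proof.
rewrite !sum_symE; apply: eq_bigr => sigma sG.
apply: eq_bigr => gamma _.
by rewrite (reindex_inj (G_inj _ sG)).
Qed.

Let sum_sym_swap F :
  sum_sym F = sum_sym (fun eta sigma gamma => F eta gamma sigma).
Proof.
apply: eq_bigr => eta _; rewrite (exchange_big_dep (mem G)) /=; last first.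
  by move=> sigma gamma _ /andP[].
apply: eq_bigr => gamma gG; apply: eq_bigl => sigma.
by rewrite gG eq_sym.
Qed.

(* Each of the three families of terms changes sign under a relabelling that
   preserves its weights: [eta] to [gamma eta] for the first, exchange of
   [sigma] and [gamma] for the second, to which [eta] to [sigma eta] reduces
   the third. *)
Lemma coupling_cancel (h : Omega -> Omega -> Omega -> Omega -> R) :
  (forall x y x' y', h x' y' x y = - h x y x' y') ->
  (forall x y x' y', h y x y' x' = h x y x' y') ->
  \sum_eta \sum_(sigma in G) \sum_(gamma in G | gamma != sigma)
    m eta * c eta sigma *
    (Num.min (c eta gamma) (c (sigma eta) gamma) *
       h eta (sigma eta) (gamma eta) (gamma (sigma eta)) +
     Num.max (c eta gamma - c (sigma eta) gamma) 0 *
       h eta (sigma eta) (gamma eta) eta +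
     Num.max (c (sigma eta) gamma - c eta gamma) 0 *
       h eta (sigma eta) (sigma eta) (gamma (sigma eta))) = 0.
Proof.
move=> h_anti h_sym.
(* The factor [m eta * c eta sigma] is moved inside the minimum and the maximum, and carried to
   [sigma eta] by [balance], so that [square_balance] can relabel the weights. *)
pose T1 eta (sigma gamma : {ffun Omega -> Omega}) :=
  Num.min (m eta * c eta sigma * c eta gamma)
    (m (sigma eta) * c (sigma eta) sigma * c (sigma eta) gamma) *
  h eta (sigma eta) (gamma eta) (gamma (sigma eta)).
pose T2 eta (sigma gamma : {ffun Omega -> Omega}) :=
  Num.max (m eta * c eta sigma * c eta gamma -
    m (sigma eta) * c (sigma eta) sigma * c (sigma eta) gamma) 0 *
  h eta (sigma eta) (gamma eta) eta.
have opp0 (x : R) : x = - x -> x = 0 by move=> ?; lra.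
have T1_0 : sum_sym T1 = 0.
  apply: opp0; rewrite {1}sum_sym_shiftr -sum_symN.
  apply: eq_sum_sym => eta sigma gamma sG gG; rewrite /T1.
  (* [square_balance] at [eta] and at [sigma eta] exchanges the two arguments of the minimum. *)
  rewrite (G_comm _ _ _ sG gG) !(square_balance _ _ _ sG gG) !G_invol// minC.
  by rewrite -mulrN -h_anti.
have T2_0 : sum_sym T2 = 0.
  apply: opp0; rewrite {1}sum_sym_swap -sum_symN.
  apply: eq_sum_sym => eta sigma gamma sG gG; rewrite /T2.
  rewrite -(square_balance _ _ _ sG gG) [m eta * c eta gamma * _]mulrAC
    [m (gamma eta) * c (gamma eta) gamma * _]mulrAC.
  by rewrite -[RHS]mulrN -h_anti h_sym.
transitivity (sum_sym T1 + sum_sym T2 +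
    sum_sym (fun eta sigma gamma => T2 (sigma eta) sigma gamma)).
  rewrite -!sum_symD; apply: eq_sum_sym => eta sigma gamma sG gG.
  rewrite /T1 /T2 G_invol// balance// -!mulrBr -minr_pMr ?rate_ge0//.
  have max0 x : Num.max (m eta * c eta sigma * x) 0 =
      m eta * c eta sigma * Num.max x 0.
    by rewrite maxr_pMr ?rate_ge0// mulr0.
  by rewrite !max0 [h (sigma eta) _ _ _]h_sym; ring.
by rewrite -(sum_sym_shiftl T2) T1_0 T2_0 !addr0.
Qed.

End Cancellation.

(** * Reversibility of the Glauber rates *)

Section Glauber.
Context {R : realType} {Omega : finType}.
Variables (beta : R) (H : Omega -> R).
Let c := glauber_rate beta H.
Let m := gibbs_measure beta H.

Lemma gibbs_measure_ge0 eta : 0 <= m eta.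
Proof.
by rewrite mulr_ge0 ?expR_ge0// invr_ge0 sumr_ge0// => xi _; exact: expR_ge0.
Qed.

(** Both sides are [expR (- (beta / 2) * (H eta + H (sigma eta)))] up to normalization. *)
Lemma glauber_balance eta (sigma : {ffun Omega -> Omega}) :
  sigma (sigma eta) = eta ->
  m (sigma eta) * c (sigma eta) sigma = m eta * c eta sigma.
Proof.
move=> sK; rewrite /m /c /gibbs_measure /glauber_rate sK -!mulrA -!expRD.
by congr (_ * expR _); field.
Qed.

(* Up to normalization, both sides are
   [expR (- (beta / 2) * (H eta + H (sigma (gamma eta))))]. *)
Lemma glauber_square_balance eta (sigma gamma : {ffun Omega -> Omega}) :
  sigma (sigma eta) = eta -> gamma (gamma eta) = eta ->
  sigma (gamma eta) = gamma (sigma eta) ->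
  m (gamma eta) * c (gamma eta) sigma * c (gamma eta) gamma =
  m (sigma eta) * c (sigma eta) sigma * c (sigma eta) gamma.
Proof.
move=> sK gK sg.
rewrite /m /c /gibbs_measure /glauber_rate sK gK sg -!mulrA -!expRD.
by congr (_ * expR _); field.
Qed.

End Glauber.

(** * Bounds from the infima *)

Section KappaInfima.
Context {R : realType} {Omega : finType}.
Variables (G : {set {ffun Omega -> Omega}})
  (c : Omega -> {ffun Omega -> Omega} -> R).
Hypothesis kappa_ge0 : forall (eta : Omega) (sigma : {ffun Omega -> Omega}),
  sigma \in G -> 0 <= kappa G c eta sigma.

Lemma kappa_star_bar_ge0 : 0 <= kappa_star_bar G c.
Proof.
rewrite /kappa_star_bar; set E := (X in inf X).
(* If [G] or [Omega] is empty, so is [E], and its infimum is 0 by convention. *)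
have [->|E0] := eqVneq E set0; first by rewrite inf0.
apply: lb_le_inf; first exact/set0P.
by move=> _ [eta [sigma [sG ->]]]; exact: kappa_ge0.
Qed.

Lemma kappa_star_bar_le eta sigma :
  sigma \in G -> kappa_star_bar G c <= kappa G c eta sigma.
Proof.
move=> sG; apply: ge_inf; last by exists eta, sigma.
by exists 0 => _ [xi [gamma [gG ->]]]; exact: kappa_ge0.
Qed.

Lemma kappa_star_le eta sigma :
  sigma \in G ->
  kappa_star G c <= kappa G c eta sigma + kappa G c (sigma eta) sigma.
Proof.
move=> sG; apply: ge_inf; last by exists eta, sigma.
by exists 0 => _ [xi [gamma [gG ->]]]; rewrite addr_ge0// kappa_ge0.
Qed.

End KappaInfima.

Lemma M_weight_le (R : realType) (theta : R * R -> R) (s t : R) :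
  (forall s t : R, 0 < s -> 0 < t -> 0 <= theta (s, t)) ->
  0 < s -> 0 < t ->
  M_weight theta * (2 * theta (s, t)) <= theta (s, s) + theta (t, t).
Proof.
move=> theta_ge0 s0 t0.
(* Pairs with [theta (s, t) = 0] do not enter the infimum; for them the left-hand side is 0. *)
have := theta_ge0 _ _ s0 t0; rewrite le_eqVlt => /predU1P[<-|st_gt0].
  by rewrite !mulr0 addr_ge0// theta_ge0.
rewrite -ler_pdivlMr ?mulr_gt0//; apply: ge_inf; last by exists s, t.
exists 0 => _ [x [y [x0 y0 xy0 ->]]].
by rewrite divr_ge0 ?addr_ge0 ?mulr_ge0 ?theta_ge0.
Qed.

(** * From the energy terms to single coupled moves *)

(** For a fixed pair the summand is linear in the generators at [eta] and at [sigma eta], so it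
    collapses to one function at each point, the input of [generator_coupling]. *)
Lemma calB_sum (R : realType) (Omega : finType)
    (G : {set {ffun Omega -> Omega}})
    (c : Omega -> {ffun Omega -> Omega} -> R) (m : Omega -> R)
    (theta : R * R -> R) (rho psi : Omega -> R) :
  calB G c m theta rho psi =
  \sum_eta \sum_(sigma in G | 0 < c eta sigma) m eta * c eta sigma *
    let d := psi eta - psi (sigma eta) in
    let th := theta (rho eta, rho (sigma eta)) in
    generator G c (fun x => 4^-1 * d ^+ 2 *
        partial1 theta (rho eta) (rho (sigma eta)) * rho x +
        (- (2^-1 * th * d)) * psi x) eta +
    generator G c (fun y => 4^-1 * d ^+ 2 *
        partial2 theta (rho eta) (rho (sigma eta)) * rho y +
        2^-1 * th * d * psi y) (sigma eta).
Proof.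
rewrite /calB /calC /calD !mulr_sumr -sumrB; apply: eq_bigr => eta _.
rewrite !mulr_sumr -sumrB; apply: eq_bigr => sigma _.
by rewrite !generator_linear; ring.
Qed.

(** Rests on [- 2 * d * (d' - d) = d ^+ 2 - d' ^+ 2 + (d - d') ^+ 2]. The last square is kept: when
    [d' = 0] it yields an extra [th * d ^+ 2]. *)
Lemma coupled_move_ge (R : realFieldType) (th th' x d d' : R) :
  th' - th <= x ->
  4^-1 * (th' * d ^+ 2 - th * d' ^+ 2 + th * (d - d') ^+ 2) <=
  4^-1 * d ^+ 2 * x - 2^-1 * th * d * (d' - d).
Proof.
move=> thx; rewrite -subr_ge0.
have -> : 4^-1 * d ^+ 2 * x - 2^-1 * th * d * (d' - d) -
    4^-1 * (th' * d ^+ 2 - th * d' ^+ 2 + th * (d - d') ^+ 2) =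
  4^-1 * (d ^+ 2 * (x - (th' - th))) by field.
by rewrite mulr_ge0// mulr_ge0 ?sqr_ge0 ?subr_ge0.
Qed.

(** * The bound for positive rates with both balance conditions *)

Section EntropicCurvature.
Context {R : realType} {Omega : finType}.
Variables (G : {set {ffun Omega -> Omega}})
  (c : Omega -> {ffun Omega -> Omega} -> R) (m : Omega -> R).
Hypothesis c_gt0 : forall eta sigma, 0 < c eta sigma.
Hypothesis m_ge0 : forall eta, 0 <= m eta.
Hypothesis G_comm : forall (eta : Omega) (sigma gamma : {ffun Omega -> Omega}),
  sigma \in G -> gamma \in G -> sigma (gamma eta) = gamma (sigma eta).
Hypothesis G_invol : forall (eta : Omega) (sigma : {ffun Omega -> Omega}),
  sigma \in G -> sigma (sigma eta) = eta.
Hypothesis balance : forall (eta : Omega) (sigma : {ffun Omega -> Omega}),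
  sigma \in G -> m (sigma eta) * c (sigma eta) sigma = m eta * c eta sigma.
Hypothesis square_balance :
  forall (eta : Omega) (sigma gamma : {ffun Omega -> Omega}),
  sigma \in G -> gamma \in G ->
  m (gamma eta) * c (gamma eta) sigma * c (gamma eta) gamma =
  m (sigma eta) * c (sigma eta) sigma * c (sigma eta) gamma.
Hypothesis kappa_ge0 : forall (eta : Omega) (sigma : {ffun Omega -> Omega}),
  sigma \in G -> 0 <= kappa G c eta sigma.
Variable theta : R * R -> R.
Hypothesis theta_ge0 : forall s t : R, 0 < s -> 0 < t -> 0 <= theta (s, t).
Hypothesis theta_sym :
  forall s t : R, 0 < s -> 0 < t -> theta (s, t) = theta (t, s).
Hypothesis theta_diff :
  forall s t : R, 0 < s -> 0 < t -> differentiable theta (s, t).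
Hypothesis theta_concave : concave_function (@pos_quadrant R) theta.

Lemma calB_ge (rho psi : Omega -> R) : (forall eta, 0 < rho eta) ->
  (M_weight theta * kappa_star_bar G c + kappa_star G c / 2) *
  calA G c m theta rho psi <= calB G c m theta rho psi.
Proof.
move=> rho_gt0.
pose Th x y := theta (rho x, rho y).
have Th_ge0 x y : 0 <= Th x y by exact: theta_ge0.
pose h x y x' y' :=
  Th x' y' * (psi x - psi y) ^+ 2 - Th x y * (psi x' - psi y') ^+ 2.
have h_anti x y x' y' : h x' y' x y = - h x y x' y' by rewrite /h; ring.
have h_sym x y x' y' : h y x y' x' = h x y x' y'.
  by rewrite /h /Th (theta_sym (rho y)) // (theta_sym (rho y')) //; ring.
have w_ge0 eta sigma : sigma \in G -> 0 <= m eta * c eta sigma.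
  by move=> _; rewrite mulr_ge0// ltW.
have cancel := coupling_cancel G c m G_comm G_invol w_ge0 balance
  square_balance h h_anti h_sym.
have c_gt0E eta : (fun sigma => (sigma \in G) && (0 < c eta sigma)) =1 mem G.
  by move=> sigma; rewrite c_gt0 andbT.
(* The vanishing sum, scaled by 1/4, is added to the smaller side; the inequality can then be
   checked separately for each [(eta, sigma)]. *)
have {}cancel := etrans (congr1 ( *%R 4^-1) cancel) (mulr0 _).
rewrite calB_sum /calA -[X in X <= _]addr0 -[X in _ + X <= _]cancel.
rewrite mulrA !mulr_sumr -big_split; apply: ler_sum => eta _ /=.
rewrite !(eq_bigl _ _ (c_gt0E eta)) !mulr_sumr -big_split.
apply: ler_sum => sigma sG /=.
rewrite -mulr_sumr -(mulrA (m eta * c eta sigma)).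
rewrite !(mulrCA _ (m eta * c eta sigma)) -mulrDr.
apply: ler_wpM2l; first exact: w_ge0.
set d := psi eta - psi (sigma eta).
rewrite -/(Th eta (sigma eta)); set th := Th eta (sigma eta).
set a := partial1 _ _ _; set b := partial2 _ _ _.
set u := (u in generator _ _ u eta).
set v := (v in generator _ _ v (sigma eta)).
rewrite generator_coupling ?G_invol//.
have move_ge x y : 4^-1 * (h eta (sigma eta) x y +
      th * (d - (psi x - psi y)) ^+ 2) <=
    u x + v y - (u eta + v (sigma eta)).
  have -> : u x + v y - (u eta + v (sigma eta)) =
      4^-1 * d ^+ 2 * (a * (rho x - rho eta) + b * (rho y - rho (sigma eta))) -
      2^-1 * th * d * ((psi x - psi y) - d).
    by rewrite /u /v /d; ring.
  apply: coupled_move_ge; apply: concave_le_partials => //.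
  exact: theta_diff.
(* Non-coalescing moves drop the square and keep only the term that cancels globally. *)
have move_ge_h x y : 4^-1 * h eta (sigma eta) x y <=
    u x + v y - (u eta + v (sigma eta)).
  apply: le_trans (move_ge x y); rewrite ler_wpM2l// lerDl.
  by rewrite mulr_ge0 ?sqr_ge0//; exact: Th_ge0.
have move_ge_diag x : 4^-1 * (Th x x + th) * d ^+ 2 <=
    u x + v x - (u eta + v (sigma eta)).
  apply: le_trans (move_ge x x); rewrite /h -/th -/d subrr.
  by rewrite le_eqVlt; apply/orP; left; apply/eqP; ring.
rewrite mulr_sumr -[leRHS]addrA [leLHS]addrC; apply: lerD.
  apply: ler_sum => gamma /andP[gG _].
  have scale_ge (r A B : R) :
      0 <= r -> 4^-1 * A <= B -> 4^-1 * (r * A) <= r * B.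
    by move=> r0 AB; rewrite mulrCA ler_wpM2l.
  rewrite mulrDr [X in X + _ <= _]mulrDr.
  by apply: lerD; [apply: lerD|]; apply: scale_ge;
    rewrite ?move_ge_h// ?le_max ?lexx ?orbT// le_min !ltW.
set k1 := kappa G c eta sigma; set k2 := kappa G c (sigma eta) sigma.
have k1_ge0 : 0 <= k1 by exact: kappa_ge0.
have k2_ge0 : 0 <= k2 by exact: kappa_ge0.
(* [k1] and [k2] are the rates at which the pair meets at [eta] and at [sigma eta]. *)
apply: le_trans (lerD (ler_wpM2l k1_ge0 (move_ge_diag eta))
  (ler_wpM2l k2_ge0 (move_ge_diag (sigma eta)))).
set kb := kappa_star_bar G c; set ks := kappa_star G c.
have -> : k1 * (4^-1 * (Th eta eta + th) * d ^+ 2) +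
    k2 * (4^-1 * (Th (sigma eta) (sigma eta) + th) * d ^+ 2) =
  4^-1 * (k1 * Th eta eta + k2 * Th (sigma eta) (sigma eta) +
    (k1 + k2) * th) * d ^+ 2 by ring.
rewrite mulrA; apply: ler_wpM2r; first exact: sqr_ge0.
have ks_le : ks * th <= (k1 + k2) * th.
  by apply: ler_wpM2r; [exact: Th_ge0|exact: kappa_star_le].
have kb_le1 : kb * Th eta eta <= k1 * Th eta eta.
  by apply: ler_wpM2r; [exact: Th_ge0|exact: kappa_star_bar_le].
have kb_le2 :
    kb * Th (sigma eta) (sigma eta) <= k2 * Th (sigma eta) (sigma eta).
  by apply: ler_wpM2r; [exact: Th_ge0|exact: kappa_star_bar_le].
have kbM := ler_wpM2l (kappa_star_bar_ge0 G c kappa_ge0)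
  (M_weight_le R theta (rho eta) (rho (sigma eta)) theta_ge0
    (rho_gt0 _) (rho_gt0 _)).
rewrite -/kb -/(Th _ _) -/th in kbM.
(* With the factor 1/2 of [calA], both shares become multiples of 1/4: the term with
   [M_weight theta] is paid by the diagonal values of [theta], the one with [ks] by the completed
   squares. *)
have -> : (M_weight theta * kb + ks / 2) / 2 * th =
  4^-1 * (kb * (M_weight theta * (2 * th)) + ks * th) by field.
apply: ler_wpM2l => //.
apply: lerD => //; apply: le_trans kbM _.
by rewrite mulrDr lerD.
Qed.
End EntropicCurvature.

(** * Specialization to the Glauber dynamics *)

Theorem theorem4p1 (R : realType) (Omega : finType)
    (G : {set {ffun Omega -> Omega}}) (H : Omega -> R) (beta : R)
    (beta_gt0 : 0 < beta)
    (G_id : [ffun eta : Omega => eta] \notin G)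
    (G_irreducible : irreducible_chain G (glauber_rate beta H))
    (G_comm : forall (eta : Omega) (sigma gamma : {ffun Omega -> Omega}),
      sigma \in G -> gamma \in G -> sigma (gamma eta) = gamma (sigma eta))
    (G_invol : forall (eta : Omega) (sigma : {ffun Omega -> Omega}),
      sigma \in G -> sigma (sigma eta) = eta)
    (kappa_ge0 : forall (eta : Omega) (sigma : {ffun Omega -> Omega}),
      sigma \in G -> 0 <= kappa G (glauber_rate beta H) eta sigma)
    (theta : R * R -> R)
    (theta_ge0 : forall s t : R, 0 < s -> 0 < t -> 0 <= theta (s, t))
    (theta_neq0 : exists s t : R, [/\ 0 < s, 0 < t & theta (s, t) <> 0])
    (theta_sym : forall s t : R, 0 < s -> 0 < t -> theta (s, t) = theta (t, s))
    (theta_diff : forall s t : R, 0 < s -> 0 < t ->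
      differentiable theta (s, t))
    (theta_concave : concave_function (@pos_quadrant R) theta)
    (rho psi : Omega -> R) (rho_gt0 : forall eta : Omega, 0 < rho eta) :
  calB G (glauber_rate beta H) (gibbs_measure beta H) theta rho psi >=
  (M_weight theta * kappa_star_bar G (glauber_rate beta H) +
   kappa_star G (glauber_rate beta H) / 2) *
  calA G (glauber_rate beta H) (gibbs_measure beta H) theta rho psi.
Proof.
apply: calB_ge => //.
- by move=> eta sigma; exact: expR_gt0.
- exact: gibbs_measure_ge0.
- by move=> eta sigma sG; apply: glauber_balance; exact: G_invol.
- move=> eta sigma gamma sG gG.
  by apply: glauber_square_balance; rewrite ?G_invol// G_comm.
Qed.
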